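(* Assume $m\geq 4$ and let $(a,b)\in\{(\pm\tfrac12,\pm\tfrac12)\}$. If $n\geq m^4$ and $\Delta_{n,m}^{(2)}\leq 3m(2\sqrt{3e}\,m)^{-m/2}$, then $$\Delta_{n,m}^{(1)}\leq 2\big(48\, m\log (1/\Delta_{n,m}^{(2)})\big)^{m/4}\Delta_{n,m}^{(2)}.$$ If $n\geq m^3$ and $\Delta_{n,m}^{(2)}\leq 2.5\,m(2\sqrt{5e}\,m)^{-m/2}$, then $$\Delta_{n,m}^{(1)}\leq 2\big(80\, m\log (1/\Delta_{n,m}^{(2)})\big)^{m/4}\Delta_{n,m}^{(2)}.$$
   Context: Standing setup. Let $n,m\geq1$ be integers and let $(a,b)\in\{-\tfrac12,\tfrac12\}^2$. Let $\rho_n^{a,b}$ be the probability density on $[0,\pi]^n$ given by $\rho_n^{--}(\theta)=\frac{2^{(n-1)^2}}{n!\pi^n}\prod_{j<k}(\cos\theta_j-\cos\theta_k)^2$, $\rho_n^{++}(\theta)=\frac{2^{n^2}}{n!\pi^n}\prod_{j}\sin^2\theta_j\prod_{j<k}(\cos\theta_j-\cos\theta_k)^2$, $\rho_n^{-+}(\theta)=\frac{2^{n^2}}{n!\pi^n}\prod_{j}\cos^2\frac{\theta_j}{2}\prod_{j<k}(\cos\theta_j-\cos\theta_k)^2$, $\rho_n^{+-}(\theta)=\frac{2^{n^2}}{n!\pi^n}\prod_{j}\sin^2\frac{\theta_j}{2}\prod_{j<k}(\cos\theta_j-\cos\theta_k)^2$. (These are the joint laws of the eigenangles of the non-deterministic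 eigenvalue pairs of Haar matrices in $SO(2n)$, $Sp(2n)$, $O(2n+1)^-$, $O(2n+1)^+$ respectively.) Write $\mathbb E^{a,b}$ for expectation under $\rho_n^{a,b}$, $\operatorname{Tr}U^k:=\sum_{j=1}^n 2\cos(k\theta_j)$, $X_k=\frac{1}{\sqrt k}(\operatorname{Tr}U^k-\mathbb E^{a,b}\operatorname{Tr}U^k)$, $\mathbf X=(X_1,\dots,X_m)$, $\mathscr P_{n,m}^{a,b}$ the density of $\mathbf X$, $\Psi_m(x)=(2\pi)^{-m/2}e^{-\|x\|^2/2}$, $\Delta_{n,m}^{(2)}=\|\mathscr P_{n,m}^{a,b}-\Psi_m\|_{L^2(\mathbb R^m)}$, $\Delta_{n,m}^{(1)}=\|\mathscr P_{n,m}^{a,b}-\Psi_m\|_{L^1(\mathbb R^m)}$. $\log$ is natural. *)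

(* Defs.v *)
From HB Require Import structures.
From mathcomp Require Import all_boot all_order all_algebra.
From mathcomp Require Import all_classical all_reals all_analysis.
Set Implicit Arguments. Unset Strict Implicit. Unset Printing Implicit Defensive.
Import Order.TTheory GRing.Theory Num.Theory.
Import numFieldNormedType.Exports.
Local Open Scope classical_set_scope.
Local Open Scope ring_scope.

Section Defs.
Variable R : realType.

Definition scons (t : R) (x : nat -> R) : nat -> R :=
  fun i => if i is i'.+1 then x i' else t.

(* Iterated Lebesgue integral over R^n of a nonnegative (extended-real)
   function of the coordinates x_0,...,x_{n-1}:
   \int dx_0 \int dx_1 ... \int dx_{n-1} f x.  (Coordinates >= n are 0.) *)
Fixpoint iint_Rn (n : nat) (f : (nat -> R) -> \bar R) : \bar R :=
  match n with
  | 0 => f (fun _ => 0)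
  | n'.+1 => (\int[@lebesgue_measure R]_(t in [set: R])
               iint_Rn n' (fun x => f (scons t x)))%E
  end.

Fixpoint iint_cube (n : nat) (f : (nat -> R) -> R) : R :=
  match n with
  | 0 => f (fun _ => 0)
  | n'.+1 => Rintegral (@lebesgue_measure R) `[0, pi]
               (fun t => iint_cube n' (fun x => f (scons t x)))
  end.

Definition rowof (m : nat) (x : nat -> R) : 'rV[R]_m := \row_(i < m) x (val i).

Definition int_Rm (m : nat) (g : 'rV[R]_m -> \bar R) : \bar R :=
  iint_Rn m (fun x => g (rowof m x)).

Definition borel_rV (m : nat) (A : set 'rV[R]_m) : Prop :=
  <<s [set: 'rV[R]_m], open >> A.

Definition borel_measurable_rV (m : nat) (p : 'rV[R]_m -> R) : Prop :=
  forall B : set R, measurable B -> borel_rV (p @^-1` B).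

Definition vdm (n : nat) (th : nat -> R) : R :=
  \prod_(j < n) \prod_(k < n | (j < k)%N) (cos (th j) - cos (th k)) ^+ 2.

Definition rho (a b : R) (n : nat) (th : nat -> R) : R :=
  if a == - 2^-1 then
    if b == - 2^-1 then
      2 ^+ ((n.-1) ^ 2) / ((n`!)%:R * pi ^+ n) * vdm n th
    else
      2 ^+ (n ^ 2) / ((n`!)%:R * pi ^+ n)
        * (\prod_(j < n) cos (th j / 2) ^+ 2) * vdm n th
  else
    if b == - 2^-1 then
      2 ^+ (n ^ 2) / ((n`!)%:R * pi ^+ n)
        * (\prod_(j < n) sin (th j / 2) ^+ 2) * vdm n th
    else
      2 ^+ (n ^ 2) / ((n`!)%:R * pi ^+ n)
        * (\prod_(j < n) sin (th j) ^+ 2) * vdm n th.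

Definition Erho (a b : R) (n : nat) (f : (nat -> R) -> R) : R :=
  iint_cube n (fun th => rho a b n th * f th).

Definition TrU (n k : nat) (th : nat -> R) : R :=
  \sum_(j < n) 2 * cos (k%:R * th j).

Definition Xk (a b : R) (n k : nat) (th : nat -> R) : R :=
  (TrU n k th - Erho a b n (TrU n k)) / Num.sqrt (k%:R).

Definition Xvec (a b : R) (n m : nat) (th : nat -> R) : 'rV[R]_m :=
  \row_(i < m) Xk a b n (val i).+1 th.

Definition is_density_of_X (a b : R) (n m : nat) (p : 'rV[R]_m -> R) : Prop :=
  [/\ (forall x, 0 <= p x), borel_measurable_rV p &
      forall A : set 'rV[R]_m, borel_rV A ->
        (Erho a b n (fun th => \1_A (Xvec a b n m th)))%:E
        = int_Rm (fun x => (p x * \1_A x)%:E)].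

Definition Psi (m : nat) (x : 'rV[R]_m) : R :=
  (2 * pi) `^ (- (m%:R / 2)) * expR (- (\sum_(i < m) x ord0 i ^+ 2) / 2).

Definition L2sq_dist (m : nat) (p q : 'rV[R]_m -> R) : \bar R :=
  int_Rm (fun x => ((p x - q x) ^+ 2)%:E).
Definition L1_dist (m : nat) (p q : 'rV[R]_m -> R) : \bar R :=
  int_Rm (fun x => `|p x - q x|%:E).

End Defs.

(* Main.v *)
Require Import Defs.
From HB Require Import structures.
From mathcomp Require Import all_boot all_order all_algebra.
From mathcomp Require Import fingroup perm.
From mathcomp Require Import all_classical all_reals all_analysis measurable_realfun.
From mathcomp Require Import ring lra zify.
Import Order.TTheory GRing.Theory Num.Theory.
Import numFieldNormedType.Exports.
Local Open Scope classical_set_scope.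
Local Open Scope ring_scope.

(* For s, r > 0 one has pointwise
     |p - Psi| + Psi <= p + s 1_{|x_i| <= r for all i} + (p - Psi)^2 / s
                          + 2 Psi sum_i exp ((x_i^2 - r^2) / 4);
   since p and Psi both have mass one, integrating bounds Delta1 by
   s (2 r)^m + Delta2^2 / s + 2 sqrt 2 m exp (- r^2 / 4). With
   r^2 = 4 log (1 / Delta2) and s = Delta2 / (2 r)^(m/2) this is
   Delta2 (2 (16 log (1 / Delta2))^(m/4) + 2 sqrt 2 m), which lies below the
   claimed bound as soon as Delta2 <= 1 / e; if Delta2 = 0, let s -> 0 and
   r -> oo instead.
   That p has mass one means that rho is normalized: rho is the square of the
   determinant of an orthogonal trigonometric family, because Chebyshev
   polynomials turn the Vandermonde product into such a determinant. *)

Set Implicit Arguments.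
Unset Strict Implicit.
Unset Printing Implicit Defensive.

(** * Tonelli calculus for iterated integrals of nonnegative functions *)

Section IteratedIntegral.
Variable R : realType.
Implicit Types (n : nat) (f g : (nat -> R) -> \bar R).
Notation mu := (@lebesgue_measure R).

(* Measurability of a function of a sequence of reals, tested along every
   coordinatewise measurable family: no sigma-algebra on [nat -> R] is needed. *)
Definition seq_measurable f :=
  forall d (T : measurableType d) (u : T -> nat -> R),
    (forall i, measurable_fun [set: T] (fun t => u t i)) ->
    measurable_fun [set: T] (fun t => f (u t)).

(** The parameter in [T] holds the coordinates not yet integrated, which lets inductions on the
    dimension enlarge [T]. *)
Definition param_measurable d (T : measurableType d)
    (F : T -> (nat -> R) -> \bar R) :=
  forall d' (T' : measurableType d') (w : T' -> T) (u : T' -> nat -> R),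
    measurable_fun [set: T'] w ->
    (forall i, measurable_fun [set: T'] (fun t => u t i)) ->
    measurable_fun [set: T'] (fun t => F (w t) (u t)).

Lemma measurable_scons d (T : measurableType d) (s : T -> R)
    (u : T -> nat -> R) :
  measurable_fun [set: T] s ->
  (forall i, measurable_fun [set: T] (fun t => u t i)) ->
  forall i, measurable_fun [set: T] (fun t => scons (s t) (u t) i).
Proof. by move=> ms mu_ [|i] /=; [exact: ms|exact: mu_]. Qed.

Lemma param_scons f : seq_measurable f ->
  param_measurable (T := measurableTypeR R) (fun t x => f (scons t x)).
Proof.
by move=> mf d' T' w u mw mu_; apply: mf; exact: measurable_scons.
Qed.

Lemma seq_measurable_scons f (t : R) :
  seq_measurable f -> seq_measurable (fun x => f (scons t x)).
Proof.
move=> mf d T u mu_; apply: mf; apply: measurable_scons => //.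
Qed.

Lemma iint_ge0 n f : (forall x, 0 <= f x)%E -> (0 <= iint_Rn n f)%E.
Proof.
elim: n f => [|n IH] f f0 /=; first exact: f0.
by apply: integral_ge0 => t _; apply: IH.
Qed.

(** Induction on [n] with [T] generalized: the outermost variable joins the parameter space, giving
    joint measurability on [T * R], and Tonelli then integrates that variable out. *)
Lemma measurable_iint n d (T : measurableType d)
    (F : T -> (nat -> R) -> \bar R) :
  param_measurable F -> (forall t x, 0 <= F t x)%E ->
  measurable_fun [set: T] (fun t => iint_Rn n (F t)).
Proof.
elim: n d T F => [|n IH] d T F mF F0 /=.
  by apply: (mF _ _ id (fun=> fun=> 0)) => // i; exact: measurable_cst.
have m2 : measurable_fun [set: T * measurableTypeR R]
    (fun z => iint_Rn n (fun x => F z.1 (scons z.2 x))).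
  apply: (IH _ _ (fun z : T * measurableTypeR R =>
    fun x => F z.1 (scons z.2 x))) => // d' T' w u mw mu_.
  apply: mF; first exact: measurableT_comp mw.
  apply: measurable_scons => //.
  exact: (measurableT_comp (measurable_snd) mw).
apply: (@measurable_fun_fubini_tonelli_F _ _ _ _ _ mu _ m2) => z.
exact: iint_ge0.
Qed.

Lemma measurable_iint_scons n f : seq_measurable f -> (forall x, 0 <= f x)%E ->
  measurable_fun [set: R] (fun t => iint_Rn n (fun x => f (scons t x))).
Proof. by move=> mf f0; apply: measurable_iint => //; exact: param_scons. Qed.

Lemma eq_iint n f g : f =1 g -> iint_Rn n f = iint_Rn n g.
Proof. by move=> /funext ->. Qed.

Lemma iint_le n f g : seq_measurable f -> seq_measurable g ->
  (forall x, 0 <= f x)%E -> (forall x, f x <= g x)%E ->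
  (iint_Rn n f <= iint_Rn n g)%E.
Proof.
elim: n f g => [|n IH] f g mf mg f0 fg /=; first exact: fg.
have g0 x : (0 <= g x)%E by exact: le_trans (fg x).
apply: ge0_le_integral => //.
- by move=> t _; exact: iint_ge0.
- exact: measurable_iint_scons.
- exact: measurable_iint_scons.
- by move=> t _; apply: IH => //; exact: seq_measurable_scons.
Qed.

Lemma iintD n f g : seq_measurable f -> seq_measurable g ->
  (forall x, 0 <= f x)%E -> (forall x, 0 <= g x)%E ->
  iint_Rn n (fun x => f x + g x)%E = (iint_Rn n f + iint_Rn n g)%E.
Proof.
elim: n f g => [//|n IH] f g mf mg f0 g0 /=.
rewrite -ge0_integralD //.
- by apply: eq_integral => t _; apply: IH => //; exact: seq_measurable_scons.
- by move=> t _; exact: iint_ge0.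
- exact: measurable_iint_scons.
- by move=> t _; exact: iint_ge0.
- exact: measurable_iint_scons.
Qed.

Lemma iintZl n f (k : R) : seq_measurable f -> (forall x, 0 <= f x)%E ->
  0 <= k -> iint_Rn n (fun x => k%:E * f x)%E = (k%:E * iint_Rn n f)%E.
Proof.
elim: n f => [//|n IH] f mf f0 k0 /=.
rewrite -ge0_integralZl //.
- by apply: eq_integral => t _; apply: IH => //; exact: seq_measurable_scons.
- exact: measurable_iint_scons.
- by move=> t _; exact: iint_ge0.
Qed.

Lemma iint0 n : iint_Rn n (fun=> 0%E : \bar R) = 0%E.
Proof.
by elim: n => [//|n IH] /=; under eq_integral do rewrite IH; exact: integral0.
Qed.

Lemma seq_measurable_sum (I : eqType) (s : seq I) (F : I -> (nat -> R) -> \bar R) :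
  (forall i, seq_measurable (F i)) -> (forall i x, 0 <= F i x)%E ->
  seq_measurable (fun x => \sum_(i <- s) F i x)%E.
Proof.
move=> mF F0 d T u mu_; apply: emeasurable_sum => i.
exact: (mF i _ _ _ mu_).
Qed.

Lemma iint_sum n (I : eqType) (s : seq I) (F : I -> (nat -> R) -> \bar R) :
  (forall i, seq_measurable (F i)) -> (forall i x, 0 <= F i x)%E ->
  iint_Rn n (fun x => \sum_(i <- s) F i x)%E =
  (\sum_(i <- s) iint_Rn n (F i))%E.
Proof.
move=> mF F0; elim: s => [|i s IH].
  by rewrite big_nil -[RHS](iint0 n); apply: eq_iint => x; rewrite big_nil.
rewrite big_cons -IH -iintD //.
- by apply: eq_iint => x; rewrite big_cons.
- exact: seq_measurable_sum.
- by move=> x; exact: sume_ge0.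
Qed.

Lemma seq_measurable_prod n (g : nat -> R -> R) :
  (forall i, measurable_fun [set: R] (g i)) ->
  seq_measurable (fun x => (\prod_(i < n) g i (x i))%:E).
Proof.
move=> mg d T u mu_; apply/measurable_EFinP; apply: measurable_prod => i _.
exact: measurableT_comp.
Qed.

(** The first factor is constant for the inner integrals and leaves them by homogeneity; what
    remains is the same product in the shifted coordinates. *)
Lemma iint_prod n (g : nat -> R -> R) (c : nat -> R) :
  (forall i, measurable_fun [set: R] (g i)) -> (forall i t, 0 <= g i t) ->
  (forall i, \int[mu]_t (g i t)%:E = (c i)%:E)%E ->
  iint_Rn n (fun x => (\prod_(i < n) g i (x i))%:E) = (\prod_(i < n) c i)%:E.
Proof.
elim: n g c => [|n IH] g c mg g0 gc /=; first by rewrite !big_ord0.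
have c0 i : 0 <= c i.
  by rewrite -lee_fin -gc; apply: integral_ge0 => t _; rewrite lee_fin.
under eq_integral => t _.
  under eq_iint => x do rewrite big_ord_recl /= EFinM.
  rewrite iintZl //; last first.
  - by move=> x; rewrite lee_fin; apply: prodr_ge0 => i _.
  - exact: (@seq_measurable_prod n (fun i => g i.+1)).
  rewrite (IH (fun i => g i.+1) (fun i => c i.+1)) //.
  over.
transitivity (\int[mu]_t ((g 0%N t)%:E * (\prod_(i < n) c i.+1)%:E))%E.
  exact: eq_integral.
rewrite ge0_integralZr ?gc -?EFinM ?big_ord_recl //.
- by apply/measurable_EFinP; exact: mg.
- by move=> t _; rewrite lee_fin.
- by rewrite lee_fin prodr_ge0.
Qed.

End IteratedIntegral.

(** * Borel sets of row vectors and coordinatewise measurability *)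

Section BorelRowVectors.
Variables (R : realType) (m : nat).

(** Rational centres and radii leave only countably many boxes, so an open set is a countable union
    of them. *)
Lemma open_rational_box (A : set 'rV[R]_m) (x : 'rV[R]_m) : open A -> A x ->
  exists z : 'rV[rat]_m * rat,
    (forall y : 'rV[R]_m,
       (forall i, `|y ord0 i - ratr (z.1 ord0 i)| < ratr z.2) -> A y) /\
    (forall i, `|x ord0 i - ratr (z.1 ord0 i)| < ratr z.2).
Proof.
move=> oA Ax; have /nbhs_ballP[e /= e0 xeA] : nbhs x A by exact: open_nbhs_nbhs.
(* A radius below [e / 2] keeps any point of the box within [e] of [x], by the triangle inequality
   through the centre. *)
have [q /[!in_itv]/= /andP[q0 qe]] := @rat_in_itvoo R 0 (e / 2) ltac:(lra).
have /choice[c cq] (i : 'I_m) :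
    exists c : rat, `|x ord0 i - ratr c| < ratr q.
  have [c /[!in_itv]/= /andP[c1 c2]] :=
    @rat_in_itvoo R (x ord0 i - ratr q) (x ord0 i + ratr q) ltac:(lra).
  by exists c; rewrite ltr_norml; apply/andP; split; lra.
exists (\row_i c i, q); split => /= [y yq|i]; last by rewrite mxE.
apply: xeA; split=> // i j; rewrite [i]ord1 /ball /=.
have := yq j; have := cq j; rewrite mxE.
rewrite (ltr_norml (x _ _ - _)) (ltr_norml (y _ _ - _)) (ltr_norml (_ - y _ _)).
by move=> /andP[? ?] /andP[? ?]; apply/andP; split; lra.
Qed.

(** Sets with measurable preimage form a sigma-algebra, so open sets suffice; these reduce to
    rational boxes, whose preimages are finite intersections of coordinate conditions. *)
Lemma measurable_preimage_rowof d (T : measurableType d) (u : T -> nat -> R)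
    (A : set 'rV[R]_m) :
  (forall i, measurable_fun [set: T] (fun t => u t i)) ->
  borel_rV A -> measurable ((fun t => rowof m (u t)) @^-1` A).
Proof.
move=> mu_; set h := (X in X @^-1` _).
suff : @borel_rV R m `<=` [set A | measurable (h @^-1` A)] by apply.
apply: smallest_sub.
  split => [|B mB|F mF].
  - by rewrite /= preimage_set0.
  - by rewrite /= setTD preimage_setC; exact: measurableC.
  - by rewrite /= preimage_bigcup; apply: bigcupT_measurable.
move=> {}A oA /=.
pose box (z : 'rV[rat]_m * rat) :=
  [set y : 'rV[R]_m | forall i, `|y ord0 i - ratr (z.1 ord0 i)| < ratr z.2].
have -> : h @^-1` A = \bigcup_(z in [set z | box z `<=` A]) (h @^-1` (box z)).
  apply/seteqP; split => [t Aht|t [z zA /zA//]].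
  by have [z [zA zx]] := open_rational_box oA Aht; exists z.
rewrite bigcup_mkcond; apply: countable_bigcupT_measurable => // z.
case: ifP => _ //.
have -> : h @^-1` box z = \bigcap_(i in [set: 'I_m])
    [set t | `|u t i - ratr (z.1 ord0 i)| < ratr z.2].
  apply/seteqP; split => t /= H i; first by have := H i; rewrite mxE.
  by rewrite mxE; exact: H.
apply: fin_bigcap_measurable => [|i _]; first exact: finite_finset.
rewrite -[X in measurable X]setTI.
apply: (@measurable_fun_ltr _ _ _ _ (fun t => `|u t i - ratr (z.1 ord0 i)|)) => //.
by apply: measurableT_comp => //; exact: measurable_funB.
Qed.

Lemma measurable_comp_rowof (g : 'rV[R]_m -> R) d (T : measurableType d)
    (u : T -> nat -> R) :
  borel_measurable_rV g -> (forall i, measurable_fun [set: T] (fun t => u t i)) ->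
  measurable_fun [set: T] (fun t => g (rowof m (u t))).
Proof.
move=> mg mu_ _ B mB; rewrite setTI.
exact: (measurable_preimage_rowof mu_ (mg _ mB)).
Qed.

End BorelRowVectors.

(** * Chebyshev-type polynomials and Vandermonde determinants *)

Section Chebyshev.

(** The matrix factors as coefficients times Vandermonde, and the degree bound makes the coefficient
    matrix triangular. *)
Lemma det_horner (K : comNzRingType) n (P : nat -> {poly K}) (x : nat -> K) :
  (forall k, (size (P k) <= k.+1)%N) ->
  \det (\matrix_(k < n, j < n) (P k).[x j]) =
  (\prod_(k < n) (P k)`_k) * \prod_(i < n) \prod_(j < n | (i < j)%N) (x j - x i).
Proof.
move=> sP.
pose L := \matrix_(k < n, j < n) (P k)`_j.
pose V := Vandermonde n (\row_(j < n) x j).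
have -> : \matrix_(k < n, j < n) (P k).[x j] = L *m V.
  apply/matrixP => k j; rewrite !mxE (horner_coef_wide _ (sP k)).
  rewrite (big_ord_widen n (fun i => (P k)`_i * x j ^+ i)) //.
  rewrite big_mkcond /=; apply: eq_bigr => i _; rewrite !mxE.
  by case: ltnP => // ki; rewrite nth_default ?mul0r // (leq_trans (sP k)).
rewrite det_mulmx det_trig; last first.
  apply/is_trig_mxP => k j kj; rewrite mxE nth_default //.
  exact: leq_trans (sP k) _.
rewrite det_Vandermonde; congr (_ * _); first by apply: eq_bigr => k _; rewrite mxE.
by apply: eq_bigr => i _; apply: eq_bigr => j _; rewrite !mxE.
Qed.

(* Chebyshev polynomials with an arbitrary degree-one term: the choices
   [X], [2X], [2X - 1], [2X + 1] give the first to fourth kinds. *)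
Fixpoint cheb_pair (K : comNzRingType) (P1 : {poly K}) (k : nat) :
    {poly K} * {poly K} :=
  if k is k'.+1 then
    let: (p, q) := cheb_pair P1 k' in (q, 2%:P * 'X * q - p)
  else (1, P1).

Definition cheb (K : comNzRingType) (P1 : {poly K}) k := (cheb_pair P1 k).1.

Variables (K : comNzRingType) (al be : K).
Let P1 : {poly K} := al%:P * 'X + be%:P.

Lemma cheb0 : cheb P1 0 = 1. Proof. by []. Qed.
Lemma cheb1 : cheb P1 1 = P1. Proof. by []. Qed.
Lemma chebSS k : cheb P1 k.+2 = 2%:P * 'X * cheb P1 k.+1 - cheb P1 k.
Proof. by rewrite /cheb /=; case: (cheb_pair P1 k). Qed.

Lemma cheb_size_coef k :
  (size (cheb P1 k.+1) <= k.+2)%N /\ (cheb P1 k.+1)`_k.+1 = al * 2 ^+ k.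
Proof.
(* The recurrence has order two, so the induction carries two consecutive indices. *)
suff [] : [/\ (size (cheb P1 k) <= k.+1)%N, (size (cheb P1 k.+1) <= k.+2)%N &
    (cheb P1 k.+1)`_k.+1 = al * 2 ^+ k] by [].
elim: k => [|k [s1 s2 c2]].
  rewrite cheb0 cheb1 size_poly1 /P1; split => //; last first.
    by rewrite coefD coefMX !coefC /= addr0 mulr1.
  by apply/leq_sizeP => j j2; rewrite coefD coefMX !coefC; case: j j2 => [|[|j]] //=;
    rewrite addr0.
rewrite chebSS; split=> //.
  apply/leq_sizeP => j j2; rewrite coefB -mulrA coefCM coefXM.
  have -> : (cheb P1 k)`_j = 0.
    by rewrite nth_default // (leq_trans s1) // ltnW // ltnW.
  rewrite subr0.
  by case: j j2 => // j j2; rewrite /= nth_default ?mulr0 // (leq_trans s2).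
rewrite coefB -mulrA coefCM coefXM /= c2.
rewrite [X in _ - X]nth_default; last by rewrite (leq_trans s1) // ltnW.
by rewrite subr0 mulrCA -exprS.
Qed.

Lemma size_cheb k : (size (cheb P1 k) <= k.+1)%N.
Proof. by case: k => [|k]; [rewrite cheb0 size_poly1|case: (cheb_size_coef k)]. Qed.

(** Both sides obey the same three-term recurrence with the same initial values. Keeping [w] as a
    factor avoids dividing by a sine or cosine that may vanish. *)
Lemma cheb_horner (w c : K) (F : nat -> K) :
  F 0%N = w -> F 1%N = w * (al * c + be) ->
  (forall k, F k.+2 = 2 * c * F k.+1 - F k) ->
  forall k, F k = w * (cheb P1 k).[c].
Proof.
move=> F0 F1 FS k.
suff [] : F k = w * (cheb P1 k).[c] /\ F k.+1 = w * (cheb P1 k.+1).[c] by [].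
elim: k => [|k [IH1 IH2]].
  by rewrite cheb0 cheb1 F0 F1 /P1 !hornerE.
split=> //; rewrite FS IH1 IH2 chebSS !hornerE.
by rewrite mulrBr !mulrA [w * 2]mulrC -[2 * w * c]mulrA [w * c]mulrC mulrA.
Qed.

End Chebyshev.

(** * Integrals over [[0, pi]] and trigonometric orthogonality *)

Section Trigonometric.
Variable R : realType.
Implicit Types (h : R -> R) (n k : nat) (t : R).
Local Notation mu := (@lebesgue_measure R).
Local Notation Ipi h := (\int[mu]_(t in `[0, pi]) h t).

Lemma integrable_pi h : continuous h -> mu.-integrable `[0, pi] (EFin \o h).
Proof.
move=> ch; apply: continuous_compact_integrable; first exact: segment_compact.
exact: continuous_subspaceT.
Qed.

Lemma continuous_lincomb (I : Type) (s : seq I) (c : I -> R) (h : I -> R -> R) :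
  (forall i, continuous (h i)) -> continuous (fun t => \sum_(i <- s) c i * h i t).
Proof.
move=> ch; elim: s => [|i s IH] t.
  by under eq_fun do rewrite big_nil; exact: cvg_cst.
under eq_fun do rewrite big_cons.
apply: cvgD; last exact: IH.
by apply: cvgM; [exact: cvg_cst|exact: ch].
Qed.

Lemma Ipi_lincomb (I : Type) (s : seq I) (c : I -> R) (h : I -> R -> R) :
  (forall i, continuous (h i)) ->
  Ipi (fun t => \sum_(i <- s) c i * h i t) = \sum_(i <- s) c i * Ipi (h i).
Proof.
move=> ch; elim: s => [|i s IH].
  by rewrite big_nil; under eq_Rintegral do rewrite big_nil; rewrite Rintegral_cst // mul0r.
rewrite big_cons -IH -RintegralZl //; last exact: integrable_pi.
rewrite -RintegralD //.
- by apply: eq_Rintegral => t _; rewrite big_cons.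
- by apply: integrable_pi => t; apply: cvgM; [exact: cvg_cst|exact: ch].
- by apply: integrable_pi; exact: continuous_lincomb.
Qed.

Lemma eq_iint_cube n (f g : (nat -> R) -> R) : f =1 g ->
  iint_cube n f = iint_cube n g.
Proof. by move=> /funext ->. Qed.

(** Linearity in one variable at a time suffices: the factor in the outer variable is absorbed into
    the coefficient [c] before the induction hypothesis is applied. *)
Lemma iint_cube_sum_prod (I : Type) (s : seq I) n (c : I -> R)
    (g : I -> 'I_n -> R -> R) : (forall i j, continuous (g i j)) ->
  iint_cube n (fun x => \sum_(i <- s) c i * \prod_(j < n) g i j (x j)) =
  \sum_(i <- s) c i * \prod_(j < n) Ipi (g i j).
Proof.
elim: n c g => [|n IH] c g cg /=.
  by apply: eq_bigr => i _; rewrite !big_ord0.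
under eq_Rintegral => t _.
  under eq_iint_cube => x do under eq_bigr => i _ do
    rewrite big_ord_recl /= mulrA.
  rewrite (IH (fun i => c i * g i ord0 t) (fun i j => g i (lift ord0 j))) //.
  under eq_bigr => i _ do rewrite mulrAC.
  over.
rewrite Ipi_lincomb //; apply: eq_bigr => i _.
by rewrite big_ord_recl -mulrA [X in _ * X]mulrC.
Qed.

Lemma sin_natM_pi k : sin (k%:R * pi) = 0 :> R.
Proof.
elim: k => [|k IH]; first by rewrite mul0r sin0.
by rewrite -addn1 natrD mulrDl mul1r sinDpi IH oppr0.
Qed.

Lemma continuous_cosM (r : R) : continuous (fun t => cos (r * t)).
Proof.
move=> t; apply: (@continuous_comp _ _ _ ( *%R r) (@cos R)).
  exact: mulrl_continuous.
exact: continuous_cos.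
Qed.

Lemma continuous_sinM (r : R) : continuous (fun t => sin (r * t)).
Proof.
move=> t; apply: (@continuous_comp _ _ _ ( *%R r) (@sin R)).
  exact: mulrl_continuous.
exact: continuous_sin.
Qed.

Lemma Ipi_cos k : Ipi (fun t => cos (k%:R * t)) = if k == 0%N then pi else 0.
Proof.
case: k => [|k] /=.
  under eq_Rintegral do rewrite mul0r cos0.
  rewrite Rintegral_cst // mul1r.
  have := @lebesgue_measure_itv R `[0, pi]; rewrite /= lte_fin pi_gt0 sube0.
  by move=> /(congr1 (@fine R)) ->.
pose a : R := k.+1%:R; have a0 : a != 0 by rewrite pnatr_eq0.
(* The antiderivative [sin (a t) / a] vanishes at both endpoints because [a] is an integer. *)
have D t : is_derive t 1 (fun t => a^-1 * sin (a * t)) (cos (a * t)).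
  have D1 : is_derive t 1 ( *%R a) a.
    rewrite -[X in is_derive _ _ _ X]mulr1; exact: is_deriveZ.
  have D2 := is_derive1_comp (is_derive_sin (a * t)) D1.
  have -> : cos (a * t) = a^-1 *: (cos (a * t) * a).
    by rewrite /GRing.scale /= mulrCA mulVf // mulr1.
  exact: is_deriveZ.
have cF : continuous (fun t => a^-1 * sin (a * t)).
  by move=> t; apply: cvgM; [exact: cvg_cst|exact: continuous_sinM].
rewrite /Rintegral (@continuous_FTC2 _ _ (fun t => a^-1 * sin (a * t))) //.
- by rewrite mulr0 sin0 sin_natM_pi !mulr0 subee.
- exact: pi_gt0.
- exact/continuous_subspaceT/continuous_cosM.
- split; first by move=> t _; exact: ex_derive.
  + by apply: cvg_at_right_filter; exact: cF.
  + by apply: cvg_at_left_filter; exact: cF.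
- by move=> t _; rewrite derive1E; exact: derive_val.
Qed.

(* With [e = 0, 1, 2] and [s = 1, -1] this covers all four families
   [cos (k t)], [sin (k.+1 t)], [cos ((k + 1/2) t)], [sin ((k + 1/2) t)]. *)
Lemma Ipi_orthogonal (F : nat -> R -> R) (e : nat) (s : R) :
  (e = 0%N -> s = 1) ->
  (forall j k t, F j t * F k t =
     (cos ((j%:R - k%:R) * t) + s * cos ((j + k + e)%N%:R * t)) / 2) ->
  forall j k, Ipi (fun t => F j t * F k t) =
    if j == k then (if (e + k == 0)%N then pi else pi / 2) else 0.
Proof.
move=> se FE j k.
(* [d] is the distance of [j] and [k]; cosine is even, so the difference frequency becomes a natural
   number and [Ipi_cos] applies. *)
pose d := (maxn j k - minn j k)%N.
have dE t : cos ((j%:R - k%:R) * t) = cos (d%:R * t) :> R.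
  rewrite /d; case: (leqP j k) => jk.
    by rewrite natrB // -cosN -mulNr opprB.
  by rewrite natrB // ltnW.
pose c (b : bool) : R := if b then 1 / 2 else s / 2.
pose h (b : bool) t : R := cos ((if b then d else (j + k + e)%N)%:R * t).
have -> : Ipi (fun t => F j t * F k t) =
    Ipi (fun t => \sum_(b <- [:: true; false]) c b * h b t).
  apply: eq_Rintegral => t _; rewrite FE dE !big_cons big_nil /c /h; lra.
rewrite Ipi_lincomb; last by move=> b; exact: continuous_cosM.
rewrite !big_cons big_nil /c /h !Ipi_cos.
have -> : (d == 0)%N = (j == k) by rewrite /d subn_eq0 geq_max !leq_min !leqnn andbT eqn_leq.
case: eqVneq => [->|jk].
  (* On the diagonal the second frequency is [2 k + e]; it is zero only for [k = e = 0], where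
     [s = 1] raises [pi / 2] to [pi]. *)
  clear c h dE d; case: e se {FE} => [|e] se.
    by rewrite se // addn0 addnn double_eq0; case: k => [|k] /=; lra.
  by rewrite !addnS /=; lra.
case: ifP => [|_]; last by lra.
by rewrite !addn_eq0 => /andP[/andP[/eqP j0 /eqP k0]]; rewrite j0 k0 eqxx in jk.
Qed.

End Trigonometric.

(** * The densities [rho] have total mass one *)

Section Normalization.
Variable R : realType.
Implicit Types (n k : nat) (t : R).
Local Notation mu := (@lebesgue_measure R).
Local Notation Ipi h := (\int[mu]_(t in `[0, pi]) h t).

(** Each [F k] is [w] times a polynomial of degree at most [k] in the cosine: [w] factors out as a
    diagonal matrix and [det_horner] handles the rest. Squaring removes the signs of the
    differences. *)
Lemma vdm_det n (F : nat -> R -> R) (w : R -> R) (al be : R) (x : nat -> R) :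
  (forall t, F 0%N t = w t) ->
  (forall t, F 1%N t = w t * (al * cos t + be)) ->
  (forall k t, F k.+2 t = 2 * cos t * F k.+1 t - F k t) ->
  (\prod_(k < n) (cheb (al%:P * 'X + be%:P) k)`_k) ^+ 2 *
    ((\prod_(j < n) w (x j) ^+ 2) * vdm n x) =
  (\det (\matrix_(j < n, k < n) F k (x j))) ^+ 2.
Proof.
move=> F0 F1 FS; set P := cheb _.
have FE k t : F k t = w t * (P k).[cos t].
  exact: (@cheb_horner _ al be (w t) (cos t) (fun k => F k t)).
have -> : \matrix_(j < n, k < n) F k (x j) =
    diag_mx (\row_j w (x j)) *m (\matrix_(k < n, j < n) (P k).[cos (x j)])^T.
  by apply/matrixP => j k; rewrite mul_diag_mx !mxE FE.
rewrite det_mulmx det_diag det_tr.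
rewrite (@det_horner _ n P (fun j => cos (x j))); last by move=> k; exact: size_cheb.
rewrite exprMn_comm; last exact: mulrC.
rewrite exprMn_comm; last exact: mulrC.
rewrite mulrCA; congr (_ * (_ * _)).
  by rewrite -prodrXl; apply: eq_bigr => j _; rewrite mxE.
rewrite -prodrXl /vdm; apply: eq_bigr => j _.
by rewrite -prodrXl; apply: eq_bigr => k _; rewrite -sqrrN opprB.
Qed.

(* Andreief's identity for an orthogonal family: only the diagonal terms of the
   squared determinant survive. *)
Lemma iint_cube_det_sqr n (F : nat -> R -> R) (N : nat -> R) (C : R) :
  (forall k, continuous (F k)) ->
  (forall j k, Ipi (fun t => F j t * F k t) = if j == k then N k else 0) ->
  iint_cube n (fun x => C * (\det (\matrix_(j < n, k < n) F k (x j))) ^+ 2) =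
  C * ((n`!)%:R * \prod_(k < n) N k).
Proof.
move=> cF orth.
(* Pairs of permutations index the terms of the expanded squared determinant. *)
pose c (p : {perm 'I_n} * {perm 'I_n}) : R := C * ((-1) ^+ p.1 * (-1) ^+ p.2).
pose g (p : {perm 'I_n} * {perm 'I_n}) (j : 'I_n) t := F (p.1 j) t * F (p.2 j) t.
transitivity (iint_cube n (fun x => \sum_p c p * \prod_(j < n) g p j (x j))).
  apply: eq_iint_cube => x; rewrite expr2 /determinant big_distrlr /= big_distrr /=.
  under eq_bigr => s _ do rewrite big_distrr /=.
  rewrite pair_big /=; apply: eq_bigr => p _.
  rewrite /c /g big_split /= -!mulrA; congr (_ * (_ * _)).
  rewrite mulrCA; congr (_ * (_ * _)).
    by apply: eq_bigr => j _; rewrite mxE.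
  by apply: eq_bigr => j _; rewrite mxE.
rewrite iint_cube_sum_prod; last first.
  by move=> p j t; apply: cvgM; exact: cF.
rewrite -(pair_bigA _ (fun s u => c (s, u) * \prod_(j < n) Ipi (g (s, u) j))) /=.
have E (s : {perm 'I_n}) : \sum_u c (s, u) * \prod_(j < n) Ipi (g (s, u) j) =
    C * \prod_(k < n) N k.
  rewrite (bigD1 s) //= [X in _ + X]big1 ?addr0; last first.
    (* Distinct permutations differ at some [j], and orthogonality kills the factor there. *)
    move=> u us; have [j sj] : exists j, s j != u j.
      apply/existsP; rewrite -negb_forall; apply: contra us => /forallP H.
      by apply/eqP/permP => j; rewrite (eqP (H j)).
    rewrite (bigD1 j) //= orth ifF ?mul0r ?mulr0 //.
    by apply/negbTE; apply: contra sj => /eqP/val_inj/eqP.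
  rewrite /c /= -signr_addb addbb mulr1; congr (_ * _).
  rewrite [RHS](reindex_inj (@perm_inj _ s)) /=; apply: eq_bigr => j _.
  by have := orth (s j) (s j); rewrite eqxx.
rewrite (eq_bigr _ (fun s _ => E s)) sumr_const card_Sn -[LHS]mulr_natl.
by rewrite mulrCA.
Qed.

Lemma iint_cube_weighted_vdm n (F : nat -> R -> R) (w : R -> R) (al be C : R)
    (N : nat -> R) :
  (forall k, continuous (F k)) ->
  (forall t, F 0%N t = w t) ->
  (forall t, F 1%N t = w t * (al * cos t + be)) ->
  (forall k t, F k.+2 t = 2 * cos t * F k.+1 t - F k t) ->
  (forall j k, Ipi (fun t => F j t * F k t) = if j == k then N k else 0) ->
  al != 0 ->
  iint_cube n (fun x => C * ((\prod_(j < n) w (x j) ^+ 2) * vdm n x)) =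
  C * ((n`!)%:R * \prod_(k < n) N k) /
    (\prod_(k < n) if (k : nat) is k'.+1 then al * 2 ^+ k' else 1) ^+ 2.
Proof.
move=> cF F0 F1 FS orth al0.
pose L := \prod_(k < n) (cheb (al%:P * 'X + be%:P) k)`_k.
have LE : L = \prod_(k < n) if (k : nat) is k'.+1 then al * 2 ^+ k' else 1 :> R.
  apply: eq_bigr => -[[|k] kn] _ /=; first by rewrite cheb0 coefC.
  by case: (cheb_size_coef al be k).
have L0 : L != 0.
  rewrite LE; apply/prodf_neq0 => -[[|k] kn] _ /=; first exact: oner_neq0.
  by rewrite mulf_neq0 // expf_neq0.
rewrite -LE mulrAC -(iint_cube_det_sqr _ _ cF orth); apply: eq_iint_cube => x.
rewrite -(vdm_det n x F0 F1 FS) -/L [RHS]mulrA divfK ?expf_neq0 //.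
Qed.

(** Matches squared leading coefficients and the [2 ^ n] from the norms [pi / 2] with the constant
    in [rho]. *)
Lemma prod_exp2_sqr n : (\prod_(k < n) (2 : R) ^+ k) ^+ 2 * 2 ^+ n = 2 ^+ (n ^ 2).
Proof.
elim: n => [|n IH]; first by rewrite big_ord0 expr1n mul1r.
have -> : (n.+1 ^ 2 = n ^ 2 + (n * 2 + 1))%N by rewrite -addn1 sqrnD; lia.
rewrite 2!exprD -IH exprM expr1 big_ord_recr /= [2 ^+ n.+1]exprS.
set L := \prod_(_ < _) _; set q := 2 ^+ n; ring.
Qed.

Lemma cos_recurrence (s : R) k t : cos ((k.+2%:R + s) * t) =
  2 * cos t * cos ((k.+1%:R + s) * t) - cos ((k%:R + s) * t).
Proof.
have -> : (k.+2%:R + s) * t = (k.+1%:R + s) * t + t by rewrite -(natr1 k.+1); ring.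
have -> : (k%:R + s) * t = (k.+1%:R + s) * t - t by rewrite -(natr1 k); ring.
by rewrite cosD cosB; ring.
Qed.

Lemma sin_recurrence (s : R) k t : sin ((k.+2%:R + s) * t) =
  2 * cos t * sin ((k.+1%:R + s) * t) - sin ((k%:R + s) * t).
Proof.
have -> : (k.+2%:R + s) * t = (k.+1%:R + s) * t + t by rewrite -(natr1 k.+1); ring.
have -> : (k%:R + s) * t = (k.+1%:R + s) * t - t by rewrite -(natr1 k); ring.
by rewrite sinD sinB; ring.
Qed.

Lemma Ipi_cos_cos (s : R) (e : nat) : e%:R = 2 * s -> forall j k,
  Ipi (fun t => cos ((j%:R + s) * t) * cos ((k%:R + s) * t)) =
    if j == k then (if (e + k == 0)%N then pi else pi / 2) else 0.
Proof.
move=> es; apply: (@Ipi_orthogonal R (fun k t => cos ((k%:R + s) * t)) e 1) => // j k t.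
have -> : (j%:R - k%:R) * t = (j%:R + s) * t - (k%:R + s) * t by ring.
have -> : (j + k + e)%N%:R * t = (j%:R + s) * t + (k%:R + s) * t.
  by rewrite !natrD es; ring.
by rewrite cosB cosD; lra.
Qed.

Lemma Ipi_sin_sin (s : R) (e : nat) : e%:R = 2 * s -> (0 < e)%N -> forall j k,
  Ipi (fun t => sin ((j%:R + s) * t) * sin ((k%:R + s) * t)) =
    if j == k then pi / 2 else 0.
Proof.
move=> es e0 j k.
rewrite (@Ipi_orthogonal R (fun k t => sin ((k%:R + s) * t)) e (-1)).
- by rewrite addn_eq0 eqn0Ngt e0.
- by move=> ez; rewrite ez in e0.
move=> {}j {}k t.
have -> : (j%:R - k%:R) * t = (j%:R + s) * t - (k%:R + s) * t by ring.
have -> : (j + k + e)%N%:R * t = (j%:R + s) * t + (k%:R + s) * t.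
  by rewrite !natrD es; ring.
by rewrite cosB cosD; lra.
Qed.

Lemma half_angle t : cos t = 1 - 2 * sin (t / 2) ^+ 2 /\
  sin t = 2 * sin (t / 2) * cos (t / 2).
Proof.
have e : t = t / 2 + t / 2 by lra.
split; first by rewrite {1}e cosD; have := cos2Dsin2 (t / 2); lra.
by rewrite {1}e sinD; ring.
Qed.

Lemma Erho_one (a b : R) n :
  (0 < n)%N -> (a = 2^-1 \/ a = - 2^-1) -> (b = 2^-1 \/ b = - 2^-1) ->
  Erho a b n (fun=> 1) = 1.
Proof.
move=> n0 ha hb.
have C0 : (n`!)%:R * pi ^+ n != 0 :> R.
  by rewrite mulf_neq0 ?expf_neq0 // ?pnatr_eq0 -?lt0n ?fact_gt0 // gt_eqF // pi_gt0.
have hne : 2^-1 == - 2^-1 :> R = false by apply/negbTE/eqP; lra.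
(* Three of the four cases share the norm [pi / 2] and the leading coefficients [2 ^ k]; they differ
   only in the family, the weight and [be]. *)
have gen (F : nat -> R -> R) (w : R -> R) (be : R) :
  (forall k, continuous (F k)) ->
  (forall t, F 0%N t = w t) ->
  (forall t, F 1%N t = w t * (2 * cos t + be)) ->
  (forall k t, F k.+2 t = 2 * cos t * F k.+1 t - F k t) ->
  (forall j k, Ipi (fun t => F j t * F k t) = if j == k then pi / 2 else 0) ->
  iint_cube n (fun x => 2 ^+ (n ^ 2) / ((n`!)%:R * pi ^+ n) *
    ((\prod_(j < n) w (x j) ^+ 2) * vdm n x)) = 1.
  move=> cF F0 F1 FS orth.
  rewrite (@iint_cube_weighted_vdm n F w 2 be _ (fun=> pi / 2)) //.
  have -> : \prod_(k < n) (if (k : nat) is k'.+1 then 2 * 2 ^+ k' else 1) =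
      \prod_(k < n) (2 : R) ^+ k.
    by apply: eq_bigr => -[[|k] kn] _ /=; rewrite ?expr0 // exprS.
  rewrite prodr_const card_ord -prod_exp2_sqr expr_div_n.
  have L0 : \prod_(k < n) (2 : R) ^+ k != 0.
    by apply/prodf_neq0 => k _; rewrite expf_neq0.
  move: L0 C0; set L := \prod_(k < n) _; set f := (n`!)%:R; set p := pi ^+ n.
  have : (2 : R) ^+ n != 0 by rewrite expf_neq0.
  set q := 2 ^+ n => q0 L0; rewrite mulf_eq0 negb_or => /andP[f0 p0].
  by field; rewrite q0 L0 f0 p0.
case: ha => ->; case: hb => ->; rewrite /Erho /rho ?eqxx ?hne.
- rewrite -[RHS](gen (fun k t => sin ((k%:R + 1) * t)) sin 0).
  + by apply: eq_iint_cube => x; rewrite mulr1 -mulrA.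
  + by move=> k; exact: continuous_sinM.
  + by move=> t; rewrite add0r mul1r.
  + by move=> t; rewrite mulrDl mul1r sinD; ring.
  + by move=> k t; exact: sin_recurrence.
  + by apply: (@Ipi_sin_sin 1 2); rewrite ?mulr1.
- rewrite -[RHS](gen (fun k t => sin ((k%:R + 2^-1) * t)) (fun t => sin (t / 2)) 1).
  + by apply: eq_iint_cube => x; rewrite mulr1 -mulrA.
  + by move=> k; exact: continuous_sinM.
  + by move=> t; rewrite add0r mulrC.
  (* With [s = sin (t / 2)] both sides equal [3 s - 4 s ^ 3]; the Pythagorean identity is multiplied
     by [s] beforehand so that only linear arithmetic remains. *)
  + move=> t; rewrite mulrDl mul1r [2^-1 * t]mulrC sinD.
    by have [-> ->] := half_angle t; have := congr1 ( *%R (sin (t / 2))) (cos2Dsin2 (t / 2)); lra.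
  + by move=> k t; exact: sin_recurrence.
  + by apply: (@Ipi_sin_sin 2^-1 1); rewrite ?divff.
- rewrite -[RHS](gen (fun k t => cos ((k%:R + 2^-1) * t)) (fun t => cos (t / 2)) (-1)).
  + by apply: eq_iint_cube => x; rewrite mulr1 -mulrA.
  + by move=> k; exact: continuous_cosM.
  + by move=> t; rewrite add0r mulrC.
  + move=> t; rewrite mulrDl mul1r [2^-1 * t]mulrC cosD.
    by have [-> ->] := half_angle t; ring.
  + by move=> k t; exact: cos_recurrence.
  + by move=> j k; rewrite (@Ipi_cos_cos 2^-1 1) ?divff.
(* In the remaining case [a = b = - 1/2] the constant function has norm [pi] and the leading
   coefficients are [1, 1, 2, 4, ...], which explains the exponent [(n - 1) ^ 2]. *)
pose F k t : R := cos ((k%:R + 0) * t).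
pose N k : R := if k == 0%N then pi else pi / 2.
transitivity (iint_cube n (fun x => 2 ^+ (n.-1 ^ 2) / ((n`!)%:R * pi ^+ n) *
    ((\prod_(j < n) (1 : R) ^+ 2) * vdm n x))).
  by apply: eq_iint_cube => x; rewrite mulr1 big1 ?mul1r // => j _; rewrite expr1n.
rewrite (@iint_cube_weighted_vdm n F (fun=> 1) 1 0 _ N) //; last 5 first.
- by move=> k; exact: continuous_cosM.
- by move=> t; rewrite /F addr0 mul0r cos0.
- by move=> t; rewrite /F !addr0 !mul1r.
- by move=> k t; exact: cos_recurrence.
- by move=> j k; rewrite (@Ipi_cos_cos 0 0) // mulr0.
case: n n0 C0 {gen} => // n _.
rewrite !big_ord_recl /= mul1r => C0.
have -> : \prod_(i < n) (1 * 2 ^+ i) = \prod_(k < n) (2 : R) ^+ k.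
  by apply: eq_bigr => k _; rewrite mul1r.
rewrite /N /= prodr_const card_ord -prod_exp2_sqr expr_div_n.
have L0 : \prod_(k < n) (2 : R) ^+ k != 0.
  by apply/prodf_neq0 => k _; rewrite expf_neq0.
have q0 : (2 : R) ^+ n != 0 by rewrite expf_neq0.
move: L0 C0 q0; rewrite exprS; set L := \prod_(k < n) _; set f := (n.+1`!)%:R.
set p := pi ^+ n; set q := 2 ^+ n => L0.
rewrite !mulf_eq0 !negb_or => /and3P[f0 pi0 p0] q0.
clearbody p; move: (@pi R) pi0 => c c0.
by field; rewrite q0 L0 f0 p0 c0.
Qed.

End Normalization.

(** * Gaussian integrals and the pointwise estimate *)

Section GaussianDensity.
Variable R : realType.
Local Notation mu := (@lebesgue_measure R).

Lemma normal_pdf01E (t : R) :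
  normal_pdf 0 1 t = (2 * pi) `^ (- 2^-1) * expR (- t ^+ 2 / 2).
Proof.
rewrite normal_pdfE ?oner_neq0 // /normal_peak /normal_fun subr0 expr1n mul1r.
congr (_ * expR (_ / _)).
by rewrite -mulr_natl powRN powR12_sqrt // mulr_ge0 // pi_ge0.
Qed.

Lemma Psi_prod m (x : nat -> R) :
  Psi (rowof m x) = \prod_(i < m) normal_pdf 0 1 (x i).
Proof.
under eq_bigr do rewrite normal_pdf01E.
rewrite big_split /= prodr_const card_ord /Psi; congr (_ * _).
  by rewrite -powR_mulrn ?powR_ge0 // -powRrM; congr (_ `^ _); ring.
rewrite -expR_sum; congr expR.
rewrite -sumrN mulr_suml; apply: eq_bigr => i _.
by rewrite mxE.
Qed.

(** The tilt turns [exp (- t^2 / 2)] into [exp (- t^2 / 4)], the profile of variance 2; the ratio of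
    the normalizing constants is [sqrt 2]. *)
Lemma integral_tilted_gaussian :
  (\int[mu]_t (normal_pdf 0 1 t * expR (t ^+ 2 / 4))%:E)%E = (Num.sqrt 2)%:E.
Proof.
have s2 : Num.sqrt 2 != 0 :> R by rewrite gt_eqF // sqrtr_gt0.
transitivity (\int[mu]_t ((Num.sqrt 2)%:E * (normal_pdf 0 (Num.sqrt 2) t)%:E))%E.
  apply: eq_integral => t _; rewrite -EFinM; congr EFin.
  rewrite !normal_pdfE ?oner_neq0 // /normal_peak /normal_fun !subr0 expr1n mul1r.
  rewrite sqr_sqrtr // -mulrA -expRD mulrA; congr (_ * expR _); last by lra.
  by rewrite -[2 * pi *+ 2]mulrnAr sqrtrM // invfM mulrA divff // mul1r.
rewrite ge0_integralZl //; first by rewrite integral_normal_pdf mule1.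
- by apply/measurable_EFinP; exact: measurable_normal_pdf.
- by move=> t _; rewrite lee_fin normal_pdf_ge0.
Qed.

Lemma iint_Psi m : iint_Rn m (fun x => (Psi (rowof m x) : R)%:E) = 1%E.
Proof.
under eq_iint do rewrite Psi_prod.
rewrite (@iint_prod R m (fun=> normal_pdf 0 1) (fun=> 1)).
- by rewrite big1.
- by move=> i; exact: measurable_normal_pdf.
- by move=> i t; exact: normal_pdf_ge0.
- by move=> i; exact: integral_normal_pdf.
Qed.

Lemma measurable_Psi m d (T : measurableType d) (u : T -> nat -> R) :
  (forall i, measurable_fun [set: T] (fun t => u t i)) ->
  measurable_fun [set: T] (fun t => Psi (rowof m (u t))).
Proof.
move=> mu_; under eq_fun do rewrite Psi_prod.
apply: measurable_prod => i _.
by apply: measurableT_comp => //; exact: measurable_normal_pdf.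
Qed.

Lemma measurable_expR_sqr : measurable_fun [set: R] (fun t => expR (t ^+ 2 / 4)).
Proof.
by apply: measurableT_comp => //; apply: measurable_funM => //; exact: measurable_funX.
Qed.

Lemma iint_tilted_Psi m (i : 'I_m) :
  iint_Rn m (fun x => (Psi (rowof m x) * expR (x i ^+ 2 / 4))%:E) =
  (Num.sqrt 2 : R)%:E.
Proof.
pose h (k : nat) (t : R) := normal_pdf 0 1 t *
  (if k == i :> nat then expR (t ^+ 2 / 4) else 1).
transitivity (iint_Rn m (fun x => (\prod_(k < m) h k (x k))%:E)).
  apply: eq_iint => x; rewrite Psi_prod [in RHS]big_split /=; congr (_ * _)%:E.
  rewrite (bigD1 i) //= eqxx big1 ?mulr1 // => k /negbTE ki.
  by rewrite -[X in if X then _ else _]/(k == i) ki.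
rewrite (@iint_prod R m h (fun k => if k == i :> nat then Num.sqrt 2 else 1)).
- rewrite (bigD1 i) //= eqxx big1 ?mulr1 // => k /negbTE ki.
  by rewrite -[X in if X then _ else _]/(k == i) ki.
- move=> k; apply: measurable_funM; first exact: measurable_normal_pdf.
  by case: (k == i :> nat) => //; exact: measurable_expR_sqr.
- move=> k t; rewrite /h mulr_ge0 ?normal_pdf_ge0 //.
  by case: ifP => _ //; exact: expR_ge0.
- move=> k; rewrite /h; case: ifP => _; first exact: integral_tilted_gaussian.
  by under eq_integral do rewrite mulr1; exact: integral_normal_pdf.
Qed.

(** Written as a product over coordinates so that [iint_prod] integrates it. *)
Definition cube_indic m (r : R) (x : nat -> R) : R :=
  \prod_(i < m) \1_`[- r, r] (x i).

Lemma iint_cube_indic m (r : R) : 0 < r ->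
  iint_Rn m (fun x => (cube_indic m r x)%:E) = ((2 * r) ^+ m)%:E.
Proof.
move=> r0; rewrite (@iint_prod R m (fun=> \1_`[- r, r]) (fun=> 2 * r)).
- by rewrite prodr_const card_ord.
- by move=> i.
- by move=> i t; rewrite indicE.
- move=> i; rewrite integral_indic // setIT.
  have := @lebesgue_measure_itv R `[- r, r]; rewrite /= lte_fin.
  have -> : - r < r by lra.
  by move=> ->; rewrite -EFinB; congr EFin; ring.
Qed.

(* Split over the cube of half-side [r]: inside, [2 d <= s + d^2 / s]; outside,
   [(Psi - p)^+ <= Psi] and some [exp ((x_i^2 - r^2) / 4) >= 1]. *)
Lemma dist_pointwise m (pv s r : R) (x : nat -> R) : 0 <= pv -> 0 < s -> 0 < r ->
  `|pv - Psi (rowof m x)| + Psi (rowof m x) <=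
  pv + (s * cube_indic m r x + (s^-1 * (pv - Psi (rowof m x)) ^+ 2 +
    2 * expR (- r ^+ 2 / 4) *
      \sum_(i < m) Psi (rowof m x) * expR (x i ^+ 2 / 4))).
Proof.
move=> p0 s0 r0; set q := Psi (rowof m x); set B := s * _; set D := s^-1 * _.
set E := \sum_(i < m) _; set S := 2 * _ * E.
have q0 : 0 <= q by rewrite /q Psi_prod prodr_ge0 // => i _; exact: normal_pdf_ge0.
have S0 : 0 <= S.
  rewrite mulr_ge0 // ?mulr_ge0 ?expR_ge0 // sumr_ge0 // => i _.
  by rewrite mulr_ge0 ?expR_ge0.
have D0 : 0 <= D by rewrite mulr_ge0 ?sqr_ge0 // invr_ge0 ltW.
have B0 : 0 <= B.
  by rewrite mulr_ge0 ?(ltW s0) // prodr_ge0 // => i _; rewrite indicE.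
(* If [q <= pv] the left side is [pv]; otherwise it is [pv + 2 (q - pv)]. *)
have [qp|pq] := leP q pv.
  by rewrite ger0_norm ?subr_ge0 //; lra.
rewrite ltr0_norm ?subr_lt0 //.
have [xr|] := boolP [forall i : 'I_m, x i \in `[- r, r]].
  suff : 2 * (q - pv) <= B + D by lra.
  have -> : B = s.
    rewrite /B /cube_indic big1 ?mulr1 // => i _; rewrite indicE.
    by move/forallP/(_ i): xr => xi; rewrite mem_set.
  rewrite -subr_ge0 /D.
  have -> : s + s^-1 * (pv - q) ^+ 2 - 2 * (q - pv) = s^-1 * (s - (q - pv)) ^+ 2.
    by field; rewrite gt_eqF.
  by rewrite mulr_ge0 ?sqr_ge0 // invr_ge0 ltW.
rewrite negb_forall => /existsP[i xi].
suff : q <= expR (- r ^+ 2 / 4) * E by rewrite /S -mulrA; lra.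
rewrite /E (bigD1 i) //= mulrDr ler_wpDr //.
  rewrite mulr_ge0 ?expR_ge0 // sumr_ge0 // => k _.
  by rewrite mulr_ge0 ?expR_ge0.
rewrite mulrCA -expRD ler_peMr // -[leLHS]expR0 ler_expR.
have : r ^+ 2 <= x i ^+ 2.
  rewrite -[x i ^+ 2]real_normK ?num_real // ler_sqr ?nnegrE ?(ltW r0) //.
  by move: xi; rewrite in_itv /= -ler_norml -ltNge; exact: ltW.
by lra.
Qed.

End GaussianDensity.

(** * From the L2 distance to the L1 distance *)

Section DistanceBounds.
Variables (R : realType) (m : nat) (p : 'rV[R]_m -> R).
Hypothesis p0 : forall x, 0 <= p x.
Hypothesis mp : borel_measurable_rV p.
Hypothesis p1 : int_Rm (fun x => (p x)%:E) = 1%E.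

(** [dist_pointwise] is integrated term by term. It is free of subtraction outside the absolute
    value and the square, so the calculus for nonnegative functions applies. *)
Lemma L1_dist_le (D s r : R) : L2sq_dist p (@Psi R m) = (D ^+ 2)%:E ->
  0 < s -> 0 < r ->
  (L1_dist p (@Psi R m) <= (s * (2 * r) ^+ m + s^-1 * D ^+ 2 +
     2 * expR (- r ^+ 2 / 4) * (m%:R * Num.sqrt 2))%:E)%E.
Proof.
move=> pD s0 r0.
have e0 : 0 <= 2 * expR (- r ^+ 2 / 4) by rewrite mulr_ge0 ?expR_ge0.
have q0 x : 0 <= Psi (rowof m x) :> R.
  by rewrite Psi_prod prodr_ge0 // => i _; exact: normal_pdf_ge0.
pose fp (x : nat -> R) : \bar R := (p (rowof m x))%:E.
pose fq (x : nat -> R) : \bar R := (Psi (rowof m x) : R)%:E.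
pose f1 (x : nat -> R) : \bar R := (`|p (rowof m x) - Psi (rowof m x)|)%:E.
pose f2 (x : nat -> R) : \bar R := ((p (rowof m x) - Psi (rowof m x)) ^+ 2)%:E.
pose fc (x : nat -> R) : \bar R := (cube_indic m r x)%:E.
pose ft (i : 'I_m) (x : nat -> R) : \bar R := (Psi (rowof m x) * expR (x i ^+ 2 / 4))%:E.
pose fs (x : nat -> R) : \bar R := (\sum_(i < m) ft i x)%E.
have mfp : seq_measurable fp.
  by move=> d T u mu_; apply/measurable_EFinP; exact: measurable_comp_rowof.
have mfq : seq_measurable fq.
  by move=> d T u mu_; apply/measurable_EFinP; exact: measurable_Psi.
have md d (T : measurableType d) (u : T -> nat -> R) :
    (forall i, measurable_fun [set: T] (fun t => u t i)) ->
    measurable_fun [set: T] (fun t => p (rowof m (u t)) - Psi (rowof m (u t))).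
  move=> mu_; apply: measurable_funB; last exact: measurable_Psi.
  exact: measurable_comp_rowof.
have mf1 : seq_measurable f1.
  by move=> d T u mu_; apply/measurable_EFinP; apply: measurableT_comp => //; exact: md.
have mf2 : seq_measurable f2.
  by move=> d T u mu_; apply/measurable_EFinP; apply: measurable_funX; exact: md.
have mfc : seq_measurable fc.
  exact: (@seq_measurable_prod R m (fun=> \1_`[- r, r])).
have mft i : seq_measurable (ft i).
  move=> d T u mu_; apply/measurable_EFinP; apply: measurable_funM.
    exact: measurable_Psi.
  exact: (measurableT_comp (@measurable_expR_sqr R) (mu_ i)).
have ft0 i x : (0 <= ft i x)%E by rewrite lee_fin mulr_ge0 ?expR_ge0.
have mfs : seq_measurable fs by exact: seq_measurable_sum.
have fs0 x : (0 <= fs x)%E by exact: sume_ge0.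
have fc0 x : (0 <= fc x)%E.
  by rewrite lee_fin prodr_ge0 // => i _; rewrite indicE.
have f20 x : (0 <= f2 x)%E by rewrite lee_fin sqr_ge0.
have mZ (k : R) g : seq_measurable g -> seq_measurable (fun x => k%:E * g x)%E.
  by move=> mg d T u mu_; apply: measurable_funeM; exact: mg.
have mD g h : seq_measurable g -> seq_measurable h ->
    seq_measurable (fun x => g x + h x)%E.
  by move=> mg mh d T u mu_; apply: emeasurable_funD; [exact: mg|exact: mh].
have si0 : 0 <= s^-1 by rewrite invr_ge0 ltW.
have Z0 (k : R) g : 0 <= k -> (forall x, 0 <= g x)%E ->
    forall x : nat -> R, (0 <= k%:E * g x)%E.
  by move=> k0 g0 x; rewrite mule_ge0.
have mr2 : seq_measurable (fun x => s^-1%:E * f2 x +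
    (2 * expR (- r ^+ 2 / 4))%:E * fs x)%E by apply: mD; exact: mZ.
have mr1 : seq_measurable (fun x => s%:E * fc x + (s^-1%:E * f2 x +
    (2 * expR (- r ^+ 2 / 4))%:E * fs x))%E by apply: mD; [exact: mZ|exact: mr2].
have : (iint_Rn m (fun x => f1 x + fq x) <= iint_Rn m (fun x => fp x +
    (s%:E * fc x + (s^-1%:E * f2 x + (2 * expR (- r ^+ 2 / 4))%:E * fs x))))%E.
  apply: iint_le => [||x|x].
  - exact: mD.
  - by apply: mD; [exact: mfp|exact: mr1].
  - by rewrite adde_ge0 // lee_fin.
  - rewrite /fs /ft sumEFin /f1 /fq /fp /fc /f2 -!EFinM -!EFinD lee_fin.
    exact: dist_pointwise.
rewrite iintD // => [|x]; last by rewrite lee_fin.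
rewrite iintD //; last 2 first.
- by move=> x; rewrite lee_fin.
- by move=> x; rewrite adde_ge0 ?Z0 ?(ltW s0) // adde_ge0 ?Z0.
rewrite iintD //; last 3 first.
- exact: mZ.
- by apply: Z0 => //; exact: ltW.
- by move=> x; rewrite adde_ge0 ?Z0.
rewrite iintD //; last 4 first.
- exact: mZ.
- exact: mZ.
- exact: Z0.
- exact: Z0.
rewrite !iintZl // ?(ltW s0) //.
rewrite iint_sum //.
under eq_bigr => i _ do rewrite iint_tilted_Psi.
rewrite iint_Psi iint_cube_indic //.
have -> : iint_Rn m fp = 1%E by exact: p1.
have -> : iint_Rn m f2 = (D ^+ 2)%:E by exact: pD.
rewrite sumEFin sumr_const card_ord -[_ *+ m]mulr_natl -!EFinM -!EFinD.
(* Both masses equal one, hence are finite and cancel, even if the L1 distance were infinite. *)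
rewrite [X in (_ <= X%:E)%E]addrC [X in (_ <= X)%E]EFinD.
rewrite leeD2rE //.
by rewrite addrA.
Qed.

Lemma L1_dist_eq0 : L2sq_dist p (@Psi R m) = 0%E ->
  (L1_dist p (@Psi R m) <= 0)%E.
Proof.
move=> pD; apply/lee_addgt0Pr => e e0; rewrite add0e.
pose k : R := 2 * (m%:R * Num.sqrt 2).
have k0 : 0 <= k by rewrite !mulr_ge0 ?ler0n ?sqrtr_ge0.
(* Chosen so that [k exp (- y) <= k / y <= e / 2]; the summand 1 keeps [y] positive when [k = 0]. *)
pose y : R := (2 * k + 1) / e.
have y0 : 0 < y by rewrite divr_gt0 //; lra.
pose r : R := 2 * Num.sqrt y.
have r0 : 0 < r by rewrite mulr_gt0 // sqrtr_gt0.
have r2 : - r ^+ 2 / 4 = - y.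
  by rewrite exprMn sqr_sqrtr ?(ltW y0) //; lra.
have d0 : 0 < (2 * r) ^+ m by rewrite exprn_gt0 // mulr_gt0.
(* The cube term then contributes exactly [e / 2]. *)
pose s := e / 2 / (2 * r) ^+ m.
have s0 : 0 < s by rewrite !divr_gt0.
apply: (le_trans (@L1_dist_le 0 s r _ s0 r0)); first by rewrite pD expr0n.
rewrite lee_fin expr0n mulr0 addr0 r2 /s divfK ?gt_eqF //.
have ey : expR (- y) <= y^-1.
  rewrite expRN lef_pV2 ?posrE ?expR_gt0 //.
  by have := expR_ge1Dx y; lra.
have : k * expR (- y) <= e / 2.
  apply: le_trans (_ : k * y^-1 <= _); first by rewrite ler_wpM2l.
  rewrite /y invf_div mulrA ler_pdivrMr; last by lra.
  by have := ltW (mulr_gt0 e0 ltr01); nra.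
rewrite /k; lra.
Qed.

Lemma L1_dist_le_ln (D K : R) : (4 <= m)%N -> 48 <= K ->
  L2sq_dist p (@Psi R m) = (D ^+ 2)%:E -> 0 < D -> D <= (expR 1)^-1 ->
  (L1_dist p (@Psi R m) <=
    (2 * (K * m%:R * ln D^-1) `^ (m%:R / 4) * D)%:E)%E.
Proof.
move=> m4 K48 pD D0 De; set L := ln D^-1.
have m4R : 4 <= m%:R :> R by rewrite (ler_nat R 4 m).
have L1 : 1 <= L.
  rewrite -[leLHS](expRK 1) /L ler_ln ?posrE ?expR_gt0 ?invr_gt0 //.
  by rewrite -[expR 1]invrK lef_pV2 ?posrE ?invr_gt0 ?expR_gt0.
have L0 : 0 <= L by lra.
pose r : R := 2 * Num.sqrt L.
have r0 : 0 < r by rewrite mulr_gt0 // sqrtr_gt0; lra.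
(* [B] is [(2 r) ^ (m / 2)]; with [s = D / B] the first two terms of [L1_dist_le] both become
   [D B]. *)
pose B : R := (16 * L) `^ (m%:R / 4).
have q1 : 1 <= m%:R / 4 :> R by lra.
have B1 : 1 <= B.
  rewrite -[leLHS](powRr0 (16 * L)) ler_powR //; lra.
have B0 : 0 < B by lra.
have rm : (2 * r) ^+ m = B ^+ 2.
  have -> : 2 * r = (16 * L) `^ (2^-1).
    rewrite powR12_sqrt ?sqrtrM //; last by lra.
    have -> : 16 = 4 ^+ 2 :> R by lra.
    by rewrite sqrtr_sqr ger0_norm // /r; lra.
  have powRX (z x : R) k : (z `^ x) ^+ k = z `^ (x * k%:R).
    by rewrite powRrM powR_mulrn // powR_ge0.
  by rewrite /B !powRX; congr (_ `^ _); lra.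
have s0 : 0 < D / B by rewrite divr_gt0.
apply: (le_trans (@L1_dist_le D (D / B) r pD s0 r0)); rewrite lee_fin rm.
have -> : - r ^+ 2 / 4 = - L.
  by rewrite exprMn sqr_sqrtr //; lra.
have -> : expR (- L) = D by rewrite expRN lnK ?posrE ?invr_gt0 // invrK.
have -> : D / B * B ^+ 2 + (D / B)^-1 * D ^+ 2 + 2 * D * (m%:R * Num.sqrt 2) =
    (2 * B + 2 * (m%:R * Num.sqrt 2)) * D.
  by field; rewrite !gt_eqF.
rewrite ler_pM2r //.
have s2 : Num.sqrt 2 <= 2 :> R.
  rewrite -[leRHS]ger0_norm // -sqrtr_sqr ler_sqrt; lra.
(* The additive [m sqrt 2 <= 2 m] is absorbed into a factor [3 m], since [B >= 1]. *)
apply: le_trans (_ : 2 * (B * (3 * m%:R)) <= _).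
  have h1 : m%:R * Num.sqrt 2 <= m%:R * 2 :> R by rewrite ler_wpM2l //; lra.
  have h2 : 0 <= (B - 1) * (3 * m%:R - 1) by rewrite mulr_ge0 //; lra.
  lra.
rewrite ler_pM2l //.
(* Splitting off [B] leaves [(K m / 16) ^ (m / 4)], which is at least [3 m] because [K >= 48] and
   [m / 4 >= 1]. *)
have -> : K * m%:R * L = 16 * L * (K / 16 * m%:R) by field.
rewrite powRM; [|lra|]; last by rewrite mulr_ge0 //; lra.
rewrite ler_wpM2l ?(ltW B0) //.
have hK : 3 * m%:R <= K / 16 * m%:R :> R by rewrite ler_wpM2r; lra.
apply: (le_trans hK); rewrite -[leLHS]powRr1; last by lra.
by rewrite ler_powR //; lra.
Qed.

End DistanceBounds.

(** * Smallness of [Delta2] and conclusion *)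

Lemma small_delta (R : realType) (m : nat) (c q : R) :
  (4 <= m)%N -> 1 <= q -> 0 <= c -> c <= 4 * q ->
  c * m%:R * (2 * Num.sqrt (q * expR 1) * m%:R) `^ (- (m%:R / 2)) <=
  (expR 1)^-1.
Proof.
move=> m4 q1 c0 cq.
have m4R : 4 <= m%:R :> R by rewrite (ler_nat R 4 m).
have e1 : 1 <= expR 1 :> R by have := expR_ge1Dx (1 : R); lra.
set X := 2 * _ * _.
have qe : 1 <= q * expR 1 by rewrite mulr_ege1.
have X2 : X ^+ 2 = 4 * q * expR 1 * m%:R ^+ 2.
  rewrite /X !exprMn sqr_sqrtr; last by lra.
  by ring.
have sq1 : 1 <= Num.sqrt (q * expR 1) by rewrite -[leLHS]sqrtr1 ler_wsqrtr.
have X1 : 1 <= X by rewrite /X -mulrA; nra.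
have X0 : 0 < X by lra.
(* As [m / 2 >= 2] and [X >= 1], two powers of [X] can be kept; the product is then at most
   [c / (4 q e m) <= 1 / e]. *)
have h : X `^ (- (m%:R / 2)) <= (X ^+ 2)^-1.
  rewrite powRN lef_pV2 ?posrE ?powR_gt0 ?exprn_gt0 //.
  by rewrite -powR_mulrn ?(ltW X0) // ler_powR //; lra.
apply: le_trans (_ : c * m%:R * (X ^+ 2)^-1 <= _).
  by rewrite ler_wpM2l // mulr_ge0 //; lra.
rewrite ler_pdivrMr ?exprn_gt0 // X2.
have -> : (expR 1)^-1 * (4 * q * expR 1 * m%:R ^+ 2) = 4 * q * m%:R ^+ 2.
  by field; rewrite gt_eqF // expR_gt0.
by rewrite expr2 mulrA ler_wpM2r //; nra.
Qed.

Unset Implicit Arguments.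

(* Delta2 is the real number D2 >= 0 with D2^2 = ||P - Psi||_2^2;
   Delta1 = ||P - Psi||_1 (possibly +oo a priori). *)
Theorem theorem0p2 (R : realType) (n m : nat) (a b : R)
  (p : 'rV[R]_m -> R) (D2 : R) :
  (4 <= m)%N ->
  (a = 2^-1 \/ a = - 2^-1) -> (b = 2^-1 \/ b = - 2^-1) ->
  is_density_of_X a b n p ->
  0 <= D2 -> L2sq_dist p (@Psi R m) = (D2 ^+ 2)%:E ->
  ((m ^ 4 <= n)%N ->
     D2 <= 3 * m%:R * (2 * Num.sqrt (3 * expR 1) * m%:R) `^ (- (m%:R / 2)) ->
     (L1_dist p (@Psi R m) <=
        (2 * (48 * m%:R * ln (D2^-1)) `^ (m%:R / 4) * D2)%:E)%E)
  /\
  ((m ^ 3 <= n)%N ->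
     D2 <= 5 / 2 * m%:R * (2 * Num.sqrt (5 * expR 1) * m%:R) `^ (- (m%:R / 2)) ->
     (L1_dist p (@Psi R m) <=
        (2 * (80 * m%:R * ln (D2^-1)) `^ (m%:R / 4) * D2)%:E)%E).
Proof.
move=> m4 ha hb [p0 mp pX] D0 pD.
have m0 : (0 < m)%N by exact: leq_trans m4.
(* Testing the density on the whole space transfers the normalization of [rho] to [p]. *)
have p1 : (0 < n)%N -> int_Rm (fun x => (p x)%:E) = 1%E.
  move=> n0; have := pX setT; rewrite indicT.
  have -> : Erho a b n (fun th => cst 1 (Xvec a b n m th)) = 1.
    exact: (Erho_one n0 ha hb).
  move=> ->; first by congr int_Rm; apply/funext => x; rewrite /cst mulr1.
  by apply: sub_sigma_algebra; exact: openT.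
have bound (K : R) : (0 < n)%N -> 48 <= K -> D2 <= (expR 1)^-1 ->
    (L1_dist p (@Psi R m) <= (2 * (K * m%:R * ln (D2^-1)) `^ (m%:R / 4) * D2)%:E)%E.
  move=> n0 K48 De; move: D0; rewrite le_eqVlt => /predU1P[z|Dpos].
    rewrite -z mulr0; apply: L1_dist_eq0 => //; first exact: p1.
    by rewrite pD -z expr0n.
  by apply: L1_dist_le_ln => //; exact: p1.
split=> hn hD; apply: bound => //.
- by apply: leq_trans hn; rewrite expn_gt0 m0.
- by apply: le_trans hD _; apply: small_delta => //; lra.
- by apply: leq_trans hn; rewrite expn_gt0 m0.
- lra.
- by apply: le_trans hD _; apply: small_delta => //; lra.
Qed.
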